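(* Let $\lambda$ be a limit ordinal. For any D-sequent $\Psi\Rightarrow_{\mathsf D}\Phi$, the following four conditions are equivalent. (1) $\mathbf{D}^3_{\rm seq}\vdash\Psi\Rightarrow_{\mathsf D}\Phi$. (2) Cut-free $\mathbf{D}^3_{\rm seq}\vdash\Psi\Rightarrow_{\mathsf D}\Phi$. (3) $\bigwedge\Psi\to\bigvee\Phi$ is true at the bottom of any constant $\lambda$-extension of any GL-model. (4) $\bigwedge\Psi\to\bigvee\Phi$ is true at the bottom of any $\lambda$-extension of any GL-model.
   Context: Formulas are built from propositional variables (the set of which is PropVar) and $\bot$ by $\to$ and $\Box$; other connectives are the usual classical abbreviations; the empty conjunction is $\top$ and the empty disjunction is $\bot$. $\Gamma,\Delta,\Pi,\Sigma,\ldots$ denote finite sets of formulas; commas denote union; $\Box\Gamma=\{\Box\gamma\mid\gamma\in\Gamma\}$. There are three kinds of sequents (tagged pairs of finite sets of formulas): GL-sequents $\Gamma\Rightarrow\Delta$, S-sequents $\Gamma\Rightarrow_{\mathsf S}\Delta$, D-sequents $\Gamma\Rightarrow_{\mathsf D}\Delta$. For each arrow $\blacktriangleright\in\{\Rightarrow,\Rightarrow_{\mathsf S},\Rightarrow_{\mathsf D}\}$, $\mathbf{LK}_{\blacktriangleright}$ has initial sequents $\varphi\blacktriangleright\varphi$ and $\bot\blacktriangleright\ $ (empty right side) and the rules: (weakening) from $\Gamma\blacktriangleright\Delta$ infer $\Gamma'\blacktriangleright\Delta'$, where $\Gamma\subseteq\Gamma'$, $\Delta\subseteq\Delta'$; ($\to$left)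 from $\Gamma\blacktriangleright\Delta,\varphi$ and $\psi,\Gamma\blacktriangleright\Delta$ infer $\varphi\to\psi,\Gamma\blacktriangleright\Delta$; ($\to$right) from $\varphi,\Gamma\blacktriangleright\Delta,\psi$ infer $\Gamma\blacktriangleright\Delta,\varphi\to\psi$; (cut) from $\Gamma\blacktriangleright\Delta,\varphi$ and $\varphi,\Pi\blacktriangleright\Sigma$ infer $\Gamma,\Pi\blacktriangleright\Delta,\Sigma$. Further rules: (GL$\Box$) from $\Gamma,\Box\Gamma,\Box\varphi\Rightarrow\varphi$ infer $\Box\Gamma\Rightarrow\Box\varphi$; (GLtoS) from $\Gamma\Rightarrow\Delta$ infer $\Gamma\Rightarrow_{\mathsf S}\Delta$; (S$\Box$left) from $\varphi,\Gamma\Rightarrow_{\mathsf S}\Delta$ infer $\Box\varphi,\Gamma\Rightarrow_{\mathsf S}\Delta$; (StoD) from $\Box\Gamma\Rightarrow_{\mathsf S}\Box\Delta$ infer $\Box\Gamma\Rightarrow_{\mathsf D}\Box\Delta$. $\mathbf{D}^3_{\rm seq}$ consists of $\mathbf{LK}_{\Rightarrow}$, $\mathbf{LK}_{\Rightarrow_{\mathsf S}}$, $\mathbf{LK}_{\Rightarrow_{\mathsf D}}$, (GL$\Box$), (GLtoS), (S$\Box$left), (StoD). Cut-free means without using any cut rule. Kripke semantics. A Kripke model $\langle W,\prec,V\rangle$ consists of a non-empty set $W$, a relation $\prec\subseteq W\times W$ and $V:W\times\mathrm{PropVar}\to\{\mathsf{true},\mathsf{false}\}$, extended to all formulas as usual,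 with $V(w,\Box\varphi)=\mathsf{true}$ iff $V(w',\varphi)=\mathsf{true}$ for all $w'$ with $w\prec w'$. A GL-model is one whose $\prec$ is transitive and converse well-founded (no infinite sequence $x_1\prec x_2\prec\cdots$). $\lambda$-extensions. For a limit ordinal $\lambda$, $\langle W^+,\prec^+\rangle$ is a $\lambda$-extension of $\langle W,\prec\rangle$ if for some $t_0\in W$: $W^+=W\uplus\{t_\alpha\mid 0<\alpha\le\lambda\}$ (disjoint union, the $t_\alpha$ distinct) and $\prec^+ = \prec\cup\{(t_\alpha,t_\beta)\mid 0\le\beta<\alpha\le\lambda\}\cup\{(t_\alpha,x)\mid 0<\alpha\le\lambda,\ t_0\prec x\}$. The world $t_\lambda$ is the bottom. A model $\langle W^+,\prec^+,V^+\rangle$ is a $\lambda$-extension of $\langle W,\prec,V\rangle$ if its frame is a $\lambda$-extension of $\langle W,\prec\rangle$ and $V^+$ coincides with $V$ on $W$. It is constant if $V^+(t_\alpha,p)=V^+(t_\beta,p)$ for all $p\in\mathrm{PropVar}$ and all $\alpha,\beta<\lambda$ (including index $0$). *)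

(* Defs.v *)
From HB Require Import structures.
From mathcomp Require Import all_boot all_order finmap.

Set Implicit Arguments.
Unset Strict Implicit.
Unset Printing Implicit Defensive.

Local Open Scope fset_scope.

Inductive formula (PropVar : Type) : Type :=
  | Var of PropVar
  | Bot
  | Imp of formula PropVar & formula PropVar
  | Box of formula PropVar.

Arguments Bot {PropVar}.

(* Encoding into GenTree.tree, used only to equip formulas with the choiceType
   structure required by {fset _}. *)
Section FormulaChoice.
Variable PropVar : Type.

Fixpoint tree_of_formula (phi : formula PropVar) : GenTree.tree PropVar :=
  match phi with
  | Var p => GenTree.Leaf p
  | Bot => GenTree.Node 0 [::]
  | Imp phi psi => GenTree.Node 1 [:: tree_of_formula phi; tree_of_formula psi]
  | Box phi => GenTree.Node 2 [:: tree_of_formula phi]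
  end.

Fixpoint formula_of_tree (t : GenTree.tree PropVar) :
    option (formula PropVar) :=
  match t with
  | GenTree.Leaf p => Some (Var p)
  | GenTree.Node 0 [::] => Some Bot
  | GenTree.Node 1 [:: t1; t2] =>
      if (formula_of_tree t1, formula_of_tree t2) is (Some phi, Some psi)
      then Some (Imp phi psi) else None
  | GenTree.Node 2 [:: t1] => omap (@Box PropVar) (formula_of_tree t1)
  | _ => None
  end.

Lemma tree_of_formulaK : pcancel tree_of_formula formula_of_tree.
Proof. by elim=> //= [phi -> psi ->|phi ->]. Qed.

End FormulaChoice.

HB.instance Definition _ (PropVar : eqType) :=
  Equality.copy (formula PropVar) (pcan_type (@tree_of_formulaK PropVar)).
HB.instance Definition _ (PropVar : choiceType) :=
  Choice.copy (formula PropVar) (pcan_type (@tree_of_formulaK PropVar)).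

Section Abbreviations.
Variable PropVar : choiceType.
Implicit Types (phi psi : formula PropVar) (Gamma : {fset formula PropVar}).

Definition Neg phi : formula PropVar := Imp phi Bot.
Definition Top : formula PropVar := Neg Bot.
Definition And phi psi : formula PropVar := Neg (Imp phi (Neg psi)).
Definition Or phi psi : formula PropVar := Imp (Neg phi) psi.

(* The conjuncts (disjuncts) are taken in the order of the canonical
   enumeration of the finite set. *)
Definition BigAnd Gamma : formula PropVar :=
  \big[And/Top]_(phi <- enum_fset Gamma) phi.
Definition BigOr Gamma : formula PropVar :=
  \big[Or/Bot]_(phi <- enum_fset Gamma) phi.

Definition BoxSet Gamma : {fset formula PropVar} :=
  [fset Box phi | phi in Gamma].

End Abbreviations.

Inductive arrow := ArrGL | ArrS | ArrD.

(* [D3seq c a Gamma Delta]: derivability of the sequent with arrow [a],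
   antecedent [Gamma] and succedent [Delta]; the cut rules are available exactly
   when [c] is true, so [D3seq false] is cut-free derivability. *)
Inductive D3seq (PropVar : choiceType) (c : bool) :
    arrow -> {fset formula PropVar} -> {fset formula PropVar} -> Prop :=
  | D3_init a phi : D3seq c a [fset phi] [fset phi]
  | D3_bot a : D3seq c a [fset Bot] fset0
  | D3_weak a Gamma Delta Gamma' Delta' :
      Gamma `<=` Gamma' -> Delta `<=` Delta' ->
      D3seq c a Gamma Delta -> D3seq c a Gamma' Delta'
  | D3_impL a Gamma Delta phi psi :
      D3seq c a Gamma (phi |` Delta) -> D3seq c a (psi |` Gamma) Delta ->
      D3seq c a (Imp phi psi |` Gamma) Delta
  | D3_impR a Gamma Delta phi psi :
      D3seq c a (phi |` Gamma) (psi |` Delta) ->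
      D3seq c a Gamma (Imp phi psi |` Delta)
  | D3_cut a Gamma Delta Pi Sigma phi :
      c = true ->
      D3seq c a Gamma (phi |` Delta) -> D3seq c a (phi |` Pi) Sigma ->
      D3seq c a (Gamma `|` Pi) (Delta `|` Sigma)
  | D3_GLbox Gamma phi :
      D3seq c ArrGL (Box phi |` (Gamma `|` BoxSet Gamma)) [fset phi] ->
      D3seq c ArrGL (BoxSet Gamma) [fset Box phi]
  | D3_GLtoS Gamma Delta :
      D3seq c ArrGL Gamma Delta -> D3seq c ArrS Gamma Delta
  | D3_SboxL Gamma Delta phi :
      D3seq c ArrS (phi |` Gamma) Delta -> D3seq c ArrS (Box phi |` Gamma) Delta
  | D3_StoD Gamma Delta :
      D3seq c ArrS (BoxSet Gamma) (BoxSet Delta) ->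
      D3seq c ArrD (BoxSet Gamma) (BoxSet Delta).

Record kripke_model (PropVar : Type) := KripkeModel {
  world :> Type;
  world_nonempty : inhabited world;
  acc : world -> world -> Prop;
  valuation : world -> PropVar -> bool
}.

Fixpoint truth (PropVar : Type) (M : kripke_model PropVar) (w : M)
    (phi : formula PropVar) : Prop :=
  match phi with
  | Var p => valuation w p = true
  | Bot => False
  | Imp phi psi => truth w phi -> truth w psi
  | Box phi => forall w' : M, acc w w' -> truth w' phi
  end.

Definition GL_model (PropVar : Type) (M : kripke_model PropVar) : Prop :=
  (forall x y z : M, acc x y -> acc y z -> acc x z) /\
  ~ (exists x : nat -> M, forall n, acc (x n) (x n.+1)).

(* An ordinal is represented by a well-ordered type lam, whose elements stand
   for the ordinals below it; the structure bOrderType provides the least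
   element \bot, standing for 0, so the ordinal is non-zero. *)
Definition limit_ordinal (d : Order.disp_t) (lam : bOrderType d) : Prop :=
  well_founded (fun a b : lam => (a < b)%O) /\
  (forall a : lam, exists b : lam, (a < b)%O).

(* Indices alpha <= lam: [Some a] is the ordinal a < lam, [None] is lam. *)
Definition ext_index (d : Order.disp_t) (lam : bOrderType d) : Type :=
  option lam.

Definition ext_index_lt (d : Order.disp_t) (lam : bOrderType d)
    (alpha beta : ext_index lam) : Prop :=
  match alpha, beta with
  | Some a, Some b => (a < b)%O
  | Some _, None => True
  | None, _ => False
  end.

Definition ext_index0 (d : Order.disp_t) (lam : bOrderType d) : ext_index lam :=
  Some (\bot%O : lam).

(* W' is the disjoint union of W, embedded by [e], and of the pairwise distinct
   worlds [t alpha] with 0 < alpha; moreover [t] sends the index 0 to (the image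
   of) the world t0 of W. *)
Definition frame_extension (d : Order.disp_t) (lam : bOrderType d)
    (W : Type) (R : W -> W -> Prop) (W' : Type) (R' : W' -> W' -> Prop)
    (e : W -> W') (t : ext_index lam -> W') : Prop :=
  exists t0 : W,
  [/\ t (ext_index0 lam) = e t0,
      injective e /\
      (forall alpha beta, ext_index_lt (ext_index0 lam) alpha ->
         ext_index_lt (ext_index0 lam) beta -> t alpha = t beta -> alpha = beta),
      forall alpha x, ext_index_lt (ext_index0 lam) alpha -> t alpha <> e x,
      forall y : W', (exists x, y = e x) \/
         (exists2 alpha, ext_index_lt (ext_index0 lam) alpha & y = t alpha)
    & forall y z : W', R' y z <->
         [\/ exists x1 x2, [/\ y = e x1, z = e x2 & R x1 x2],
             exists alpha beta, [/\ y = t alpha, z = t beta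
                                  & ext_index_lt beta alpha]
           | exists alpha x, [/\ y = t alpha, z = e x,
                                 ext_index_lt (ext_index0 lam) alpha & R t0 x]]].

Definition model_extension (PropVar : Type) (d : Order.disp_t)
    (lam : bOrderType d) (M M' : kripke_model PropVar)
    (e : M -> M') (t : ext_index lam -> M') : Prop :=
  frame_extension (@acc _ M) (@acc _ M') e t /\
  (forall (x : M) (p : PropVar), valuation (e x) p = valuation x p).

Definition constant_extension (PropVar : Type) (d : Order.disp_t)
    (lam : bOrderType d) (M' : kripke_model PropVar)
    (t : ext_index lam -> M') : Prop :=
  forall (p : PropVar) (a b : lam),
    valuation (t (Some a)) p = valuation (t (Some b)) p.

Definition bottom_world (PropVar : Type) (d : Order.disp_t) (lam : bOrderType d)
    (M' : kripke_model PropVar) (t : ext_index lam -> M') : M' := t None.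

(* Main.v *)
(** Soundness of the calculus with cut and completeness of the cut-free calculus
    close the circle 1 -> 4 -> 3 -> 2 -> 1.

    Soundness reads a GL-sequent as true at every world of the extension, an
    S-sequent as true at [t_b] for all sufficiently large [b < lambda], and a
    D-sequent as true at [t_lambda].  The rule (S-Box-left) is sound because a
    failure of [phi] at one [t_b] refutes [Box phi] at every later one; (StoD) is
    sound because a box false at [t_lambda] is false at all sufficiently late [t_b].

    For completeness, an underivable D-sequent is saturated; its boxed part is an
    underivable S-sequent, which is saturated again (now also under unboxing the
    antecedent) and is in particular an underivable GL-sequent, hence refuted at a
    world [t_0] of a GL-model.  Copying the valuation of [t_0] to all [t_b] with
    [b < lambda] refutes the S-sequent at each of them, and giving [t_lambda] the
    valuation read off the D-sequent refutes the latter there. *)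
Require Import Defs.
From mathcomp Require Import all_boot all_order finmap.
From Stdlib Require Import Classical ClassicalEpsilon.

Set Implicit Arguments.
Unset Strict Implicit.
Unset Printing Implicit Defensive.

Import Order.TTheory.
Local Open Scope fset_scope.

Section Sequents.
Variable PropVar : choiceType.
Implicit Types (phi psi : formula PropVar) (G D U : {fset formula PropVar}).

(** * Truth of sequents *)

Definition seq_true (M : kripke_model PropVar) G D (w : M) : Prop :=
  (forall phi, phi \in G -> truth w phi) ->
  exists2 phi, phi \in D & truth w phi.

Lemma truth_BigAnd (M : kripke_model PropVar) (w : M) G :
  truth w (BigAnd G) <-> forall phi, phi \in G -> truth w phi.
Proof.
suff H (s : seq (formula PropVar)) :
    truth w (\big[@And PropVar/@Top PropVar]_(phi <- s) phi) <->
    forall phi, phi \in s -> truth w phi by exact: (H (enum_fset G)).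
elim: s => [|chi s IHs]; first by rewrite big_nil; split=> // _ [].
rewrite big_cons /=; split=> [nimp phi|all_s].
  rewrite inE => /predU1P[->|phi_s].
    by apply: NNPP => nchi; apply: nimp.
  apply: (proj1 IHs) phi_s; apply: NNPP => ns; apply: nimp => _; exact: ns.
apply; first by apply: all_s; rewrite mem_head.
by apply/IHs => phi phi_s; apply: all_s; rewrite inE phi_s orbT.
Qed.

Lemma truth_BigOr (M : kripke_model PropVar) (w : M) D :
  truth w (BigOr D) <-> exists2 phi, phi \in D & truth w phi.
Proof.
suff H (s : seq (formula PropVar)) :
    truth w (\big[@Or PropVar/Bot]_(phi <- s) phi) <->
    exists2 phi, phi \in s & truth w phi by exact: (H (enum_fset D)).
elim: s => [|chi s IHs]; first by rewrite big_nil; split=> // -[].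
rewrite big_cons /=; split=> [imp|[phi]].
  have [tchi|nchi] := classic (truth w chi); first by exists chi; rewrite ?mem_head.
  have /IHs[phi phi_s tphi] := imp nchi.
  by exists phi; rewrite // inE phi_s orbT.
rewrite inE => /predU1P[-> //|phi_s tphi] _.
by apply/IHs; exists phi.
Qed.

Lemma truth_sequent (M : kripke_model PropVar) (w : M) G D :
  truth w (Imp (BigAnd G) (BigOr D)) <-> seq_true G D w.
Proof.
split=> /= H.
  by move=> /truth_BigAnd/H/truth_BigOr.
by move=> /truth_BigAnd/H/truth_BigOr.
Qed.

Lemma mem_BoxSet G phi : (Box phi \in BoxSet G) = (phi \in G).
Proof.
apply/imfsetP/idP => [[psi /= psiG [->]] //|phiG].
by exists phi.
Qed.

(** * Converse well-foundedness *)

(** Dependent choice: a non-accessible world has a non-accessible successor, and iterating a choice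
    of such successors builds an infinite chain. *)
Lemma conv_wf_of_no_chain (W : Type) (R : W -> W -> Prop) :
  ~ (exists x : nat -> W, forall n, R (x n) (x n.+1)) ->
  well_founded (fun y x => R x y).
Proof.
move=> nochain w; apply: NNPP => nacc_w.
pose bad := {x : W | ~ Acc (fun y x => R x y) x}.
have step (x : bad) : {y : bad | R (sval x) (sval y)}.
  apply: constructive_indefinite_description; apply: NNPP => none.
  case: x none => x nacc_x none; apply: (nacc_x); constructor=> y Rxy.
  by apply: NNPP => nacc_y; apply: none; exists (exist _ y nacc_y).
apply: nochain.
exists (fun n => sval (iter n (fun x => sval (step x)) (exist _ w nacc_w))) => n.
exact: (svalP (step _)).
Qed.

(** Löb's argument. At a successor [v] of [w] the boxes of the antecedent persist by transitivity,
    and [Box phi] holds at [v] by well-founded induction, so the premise applies there. *)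
Lemma GLbox_sound (M : kripke_model PropVar) G phi :
  (forall x y z : M, acc x y -> acc y z -> acc x z) ->
  well_founded (fun y x : M => acc x y) ->
  (forall w : M, seq_true (Box phi |` (G `|` BoxSet G)) [fset phi] w) ->
  forall w : M, seq_true (BoxSet G) [fset Box phi] w.
Proof.
move=> tr wf prem w tG; exists (Box phi); first exact: fset11.
elim: (wf w) tG => {}w _ IHw tG v wv.
have tGv psi : psi \in BoxSet G -> truth v psi.
  case/imfsetP=> chi /= chiG -> u vu.
  by apply: (tG (Box chi)) (tr _ _ _ wv vu); rewrite mem_BoxSet.
have [psi|psi /fset1P -> //] := prem v.
rewrite in_fset1U in_fsetU => /predU1P[->|/orP[psiG|]]; last exact: tGv.
  exact: IHw.
by apply: (tG (Box psi)); rewrite ?mem_BoxSet.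
Qed.

(** * Frames of extensions *)

Section Extension.
Variables (d : Order.disp_t) (lam : bOrderType d).
Implicit Types (alpha beta : ext_index lam).
Local Notation "alpha <' beta" := (ext_index_lt alpha beta) (at level 70).
Local Notation zero := (ext_index0 lam).

Lemma ext_index_lt_trans beta alpha gamma :
  alpha <' beta -> beta <' gamma -> alpha <' gamma.
Proof.
by case: alpha beta gamma => [a|] [b|] [c|] //=; exact: lt_trans.
Qed.

Lemma ext_index_gt0 alpha : zero <' alpha <-> alpha != zero.
Proof.
by case: alpha => [a|] //; rewrite /zero /= lt0x; split=> /eqP H; apply/eqP;
  [move=> [/H] | move=> E; apply: H; rewrite E].
Qed.

Lemma ext_index_lt_gt0 alpha beta : beta <' alpha -> zero <' alpha.
Proof.
by case: alpha beta => [a|] [b|] //=; apply: le_lt_trans; exact: le0x.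
Qed.

Lemma ext_index_wf :
  limit_ordinal lam -> well_founded (@ext_index_lt d lam).
Proof.
case=> wf _; have accS a : Acc (@ext_index_lt d lam) (Some a).
  by elim: (wf a) => {}a _ IHa; constructor=> -[b|[]] ba; exact: (IHa b ba).
by case=> [//|]; constructor=> -[].
Qed.

Section Frame.
Variables (M M' : kripke_model PropVar) (e : M -> M') (t : ext_index lam -> M').
Hypothesis ext : model_extension e t.

Lemma ext_acc_e x z : acc (e x) z <-> exists2 y, z = e y & acc x y.
Proof.
have [[t0 [_ [inj_e _] tNe _ accE]] _] := ext; split=> [/accE|[y -> xy]]; last first.
  by apply/accE; apply: Or31; exists x, y.
case=> [[x1 [x2 [/inj_e -> -> ?]]]|[a [b [E _ ba]]]|[a [y [E _ a0 _]]]].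
- by exists x2.
- by case: (tNe a x (ext_index_lt_gt0 ba)).
- by case: (tNe a x a0).
Qed.

(** The image of [e] is closed under successors, so [M] is a generated submodel of [M']. *)
Lemma ext_truth_e x phi : truth (e x) phi <-> truth x phi.
Proof.
have [_ valE] := ext.
elim: phi x => [p|//|phi IH1 psi IH2|phi IH] x /=; first by rewrite valE.
  by split=> H /IH1/H/IH2.
split=> H y.
  by move=> xy; apply/IH/H/ext_acc_e; exists y.
by case/ext_acc_e=> y' -> xy'; apply/IH/H.
Qed.

(** Disjointness and injectivity turn the frame clauses into a case split on the successors of
    [t alpha]. Index 0 is kept apart because [t zero] is an old world, which sees old worlds
    only. *)
Lemma ext_root : exists t0 : M, t zero = e t0 /\
  forall alpha z, zero <' alpha ->
    acc (t alpha) z <->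
    (exists2 beta, z = t beta & beta <' alpha) \/
    (exists2 x, z = e x & acc t0 x).
Proof.
have [[t0 [t00 [_ inj_t] tNe _ accE]] _] := ext; exists t0; split=> // alpha z a0.
split=> [/accE|[[beta -> ba]|[x -> t0x]]].
- case=> [[x1 [x2 [/(tNe _ _ a0)]]]|[a [b [E -> ba]]]
         |[a [x [_ -> _ t0x]]]] //; last by right; exists x.
  by left; exists b; rewrite // (inj_t _ _ a0 (ext_index_lt_gt0 ba) E).
- by apply/accE; apply: Or32; exists alpha, beta.
- by apply/accE; apply: Or33; exists alpha, x.
Qed.

Lemma ext_trans :
  (forall x y z : M, acc x y -> acc y z -> acc x z) ->
  forall x y z : M', acc x y -> acc y z -> acc x z.
Proof.
move=> tr; have [t0 [t00 acc_t]] := ext_root.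
have [[_ [_ _ _ cover _]] _] := ext => x y z.
case: (cover x) => [[{}x ->]|[a a0 ->]].
  case/ext_acc_e=> {}y -> xy /ext_acc_e[{}z -> yz].
  by apply/ext_acc_e; exists z => //; exact: tr yz.
case/(acc_t _ _ a0)=> [[b -> ba]|[{}y -> t0y]]; last first.
  case/ext_acc_e=> {}z -> yz.
  by apply/(acc_t _ _ a0); right; exists z => //; exact: tr yz.
have [->|/ext_index_gt0 b0] := eqVneq b zero.
  rewrite t00 => /ext_acc_e[{}z -> t0z].
  by apply/(acc_t _ _ a0); right; exists z.
case/(acc_t _ _ b0)=> [[c -> cb]|[{}z -> t0z]]; apply/(acc_t _ _ a0).
  by left; exists c => //; exact: ext_index_lt_trans ba.
by right; exists z.
Qed.

(** Old worlds come first, by induction in [M]; then the [t alpha], by induction on the ordinal,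
    since these see only old worlds and smaller indices. *)
Lemma ext_conv_wf :
  limit_ordinal lam -> well_founded (fun y x : M => acc x y) ->
  well_founded (fun y x : M' => acc x y).
Proof.
move=> limlam wf; have [t0 [t00 acc_t]] := ext_root.
have acc_e x : Acc (fun y x : M' => acc x y) (e x).
  elim: (wf x) => {}x _ IHx.
  by constructor=> _ /ext_acc_e[y -> /IHx].
have [[_ [_ _ _ cover _]] _] := ext => x.
case: (cover x) => [[{}x ->] //|[a _ ->]].
elim: (ext_index_wf limlam a) => {}a _ IHa.
have [->|/ext_index_gt0 a0] := eqVneq a zero; first by rewrite t00.
by constructor=> y /(acc_t _ _ a0)[[b -> /IHa]|[z -> _]].
Qed.

(** * Soundness *)

(** For each arrow these properties form a filter: they are closed under consequence and binary
    meets. This lets the LK rules be checked pointwise, for all arrows at once. *)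
Definition arrow_ev (a : arrow) (P : M' -> Prop) : Prop :=
  match a with
  | ArrGL => forall w, P w
  | ArrS => exists a0 : lam, forall b, (a0 <= b)%O -> P (t (Some b))
  | ArrD => P (t None)
  end.

Lemma arrow_evT a (P : M' -> Prop) : (forall w, P w) -> arrow_ev a P.
Proof. by case: a => H //=; exists \bot%O => b _; exact: H. Qed.

Lemma arrow_ev2 a (P Q S : M' -> Prop) :
  (forall w, P w -> Q w -> S w) -> arrow_ev a P -> arrow_ev a Q -> arrow_ev a S.
Proof.
case: a => /= H; [|case=> x Px [y Qy]|]; try by firstorder.
by exists (Order.max x y) => b; rewrite ge_max => /andP[xb yb]; apply: H; auto.
Qed.

Lemma arrow_ev1 a (P S : M' -> Prop) :
  (forall w, P w -> S w) -> arrow_ev a P -> arrow_ev a S.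
Proof. by move=> H evP; apply: (arrow_ev2 (P := P) (Q := P)) => // w /H. Qed.

Lemma ext_acc_t alpha beta : beta <' alpha -> acc (t alpha) (t beta).
Proof.
have [t0 [_ acc_t]] := ext_root => ba.
by apply/acc_t; [exact: ext_index_lt_gt0 ba|left; exists beta].
Qed.

Lemma SboxL_sound G D phi : limit_ordinal lam ->
  arrow_ev ArrS (seq_true (phi |` G) D) ->
  arrow_ev ArrS (seq_true (Box phi |` G) D).
Proof.
move=> [_ unbdd] [a0 Ha0].
(* If [phi] fails at some [t_a], then [Box phi] is false beyond [a] and the conclusion is vacuous
   there; otherwise the threshold of the premise still serves. *)
have [[a na]|alla] := classic (exists a : lam, ~ truth (t (Some a)) phi).
  have [c ac] := unbdd a; exists c => b cb tG; case: na.
  apply: (tG (Box phi) (fset1U1 _ _)); apply: ext_acc_t.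
  exact: lt_le_trans ac cb.
exists a0 => b ab tG; apply: (Ha0 b ab) => psi.
case/fset1UP=> [->|psiG]; last by apply: tG; rewrite fset1Ur.
by apply: NNPP => nphi; apply: alla; exists b.
Qed.

(** A successor of the bottom refuting [phi] is either some [t_a], seen from every later index, or
    an old world above [t0], seen from every positive index. *)
Lemma Box_eventually_false phi : limit_ordinal lam ->
  ~ truth (t None) (Box phi) ->
  exists a : lam, forall b, (a <= b)%O -> ~ truth (t (Some b)) (Box phi).
Proof.
move=> [_ unbdd] nbox.
have [z [Nz nz]] : exists z, acc (t None) z /\ ~ truth z phi.
  apply: NNPP => none; apply: nbox => z Nz; apply: NNPP => nz.
  by apply: none; exists z.
have [t0 [_ acc_t]] := ext_root.
case/(acc_t None _ I): Nz nz => [[[a|//] -> _]|[x -> t0x]] nz; last first.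
  have [c ac] := unbdd \bot%O; exists c => b cb tb; apply: nz; apply: tb.
  by apply/acc_t; [exact: lt_le_trans ac cb|right; exists x].
have [c ac] := unbdd a; exists c => b cb tb; apply: nz; apply: tb.
by apply: ext_acc_t; exact: lt_le_trans ac cb.
Qed.

(** As [D] is finite, the maximum of the individual thresholds works for all its boxes. *)
Lemma Boxes_eventually_false D : limit_ordinal lam ->
  ~ (exists2 phi, phi \in BoxSet D & truth (t None) phi) ->
  exists a : lam, forall b, (a <= b)%O ->
    forall phi, phi \in BoxSet D -> ~ truth (t (Some b)) phi.
Proof.
move=> limlam none.
have {none} : forall phi, phi \in enum_fset D -> ~ truth (t None) (Box phi).
  by move=> phi phiD tphi; apply: none; exists (Box phi); rewrite ?mem_BoxSet.
suff H (s : seq (formula PropVar)) :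
    (forall phi, phi \in s -> ~ truth (t None) (Box phi)) ->
    exists a : lam, forall b, (a <= b)%O ->
      forall phi, phi \in s -> ~ truth (t (Some b)) (Box phi).
  case/H=> a Ha; exists a => b ab phi /imfsetP[psi /= psiD ->].
  exact: Ha ab psi psiD.
elim: s => [|chi s IHs] none; first by exists \bot%O.
have [a Ha] := Box_eventually_false limlam (none chi (mem_head _ _)).
have [|c Hc] := IHs; first by move=> phi phis; apply: none; rewrite inE phis orbT.
exists (Order.max a c) => b; rewrite ge_max => /andP[ab cb] phi.
by rewrite inE => /predU1P[->|/Hc]; [exact: Ha|exact].
Qed.

Lemma StoD_sound G D : limit_ordinal lam ->
  (forall x y z : M', acc x y -> acc y z -> acc x z) ->
  arrow_ev ArrS (seq_true (BoxSet G) (BoxSet D)) ->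
  arrow_ev ArrD (seq_true (BoxSet G) (BoxSet D)).
Proof.
move=> limlam tr [a0 Ha0] tG; apply: NNPP => /(Boxes_eventually_false limlam)[a Ha].
(* Past both thresholds the premise holds while every box of the succedent is false; the boxes of
   the antecedent descend from the bottom to [t_b] by transitivity. *)
pose b := Order.max a0 a.
have [||phi phiD] := Ha0 b; first by rewrite le_max lexx.
  move=> psi psiG; have /imfsetP[chi _ psiE] := psiG.
  have := tG _ psiG; rewrite psiE => tchi v bv; apply: tchi.
  by apply: tr bv; exact: ext_acc_t.
by apply: Ha phiD; rewrite le_max lexx orbT.
Qed.

Lemma D3seq_sound c a G D : limit_ordinal lam -> GL_model M ->
  D3seq c a G D -> arrow_ev a (seq_true G D).
Proof.
move=> limlam [trM /conv_wf_of_no_chain wfM].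
have tr := ext_trans trM; have wf := ext_conv_wf limlam wfM.
elim=> {a G D}.
- move=> a phi; apply: arrow_evT => w tG.
  by exists phi; [exact: fset11|apply/tG/fset11].
- by move=> a; apply: arrow_evT => w /(_ _ (fset11 _)).
- move=> a G D G' D' /fsubsetP sG /fsubsetP sD _; apply: arrow_ev1 => w tGD tG'.
  have [|phi /sD phiD' tphi] := tGD; last by exists phi.
  by move=> psi /sG; exact: tG'.
- move=> a G D phi psi _ + _; apply: arrow_ev2 => w t1 t2 tG.
  have tG' chi : chi \in G -> truth w chi by move=> chiG; apply: tG; rewrite fset1Ur.
  have [chi /fset1UP[-> tphi|]] := t1 tG'; last by exists chi.
  apply: t2 => chi' /fset1UP[->|]; last exact: tG'.
  exact: (tG _ (fset1U1 _ _)).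
- move=> a G D phi psi _; apply: arrow_ev1 => w t1 tG.
  have [tphi|nphi] := classic (truth w phi); last first.
    by exists (Imp phi psi); [exact: fset1U1|move=> /nphi].
  have [|chi /fset1UP[->|chiD] tchi] := t1; first by move=> chi /fset1UP[->|/tG].
    by exists (Imp phi psi); [exact: fset1U1|].
  by exists chi => //; rewrite fset1Ur.
- move=> a G D P S phi _ _ + _; apply: arrow_ev2 => w t1 t2 tGP.
  have [|chi /fset1UP[->|chiD] tchi] := t1.
  + by move=> chi chiG; apply: tGP; rewrite in_fsetU chiG.
  + have [|chi' chiS tchi'] := t2; last by exists chi'; rewrite // in_fsetU chiS orbT.
    by move=> chi' /fset1UP[->|chiP] //; apply: tGP; rewrite in_fsetU chiP orbT.
  + by exists chi => //; rewrite in_fsetU chiD.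
- by move=> G phi _; exact: GLbox_sound.
- by move=> G D _ H; exists \bot%O => b _.
- by move=> G D phi _; exact: SboxL_sound.
- by move=> G D _; exact: StoD_sound.
Qed.

End Frame.
End Extension.

(** * Saturation in the cut-free calculus *)

Local Notation cf := (D3seq false).

Definition sub_closed U : Prop :=
  (forall phi psi, Imp phi psi \in U -> phi \in U /\ psi \in U) /\
  (forall phi, Box phi \in U -> phi \in U).

(** * Subformula closure of a finite set *)

Fixpoint subf phi : seq (formula PropVar) :=
  phi :: match phi with
         | Imp phi1 phi2 => subf phi1 ++ subf phi2
         | Box phi1 => subf phi1
         | _ => [::]
         end.

Lemma subf_refl phi : phi \in subf phi.
Proof. by case: phi => *; rewrite /= mem_head. Qed.

Lemma subf_Imp chi phi psi :
  Imp phi psi \in subf chi -> phi \in subf chi /\ psi \in subf chi.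
Proof.
elim: chi => [p|//|chi1 IH1 chi2 IH2|chi IH] //=; rewrite !inE //.
  rewrite !mem_cat => /orP[/eqP[-> ->]|/orP[/IH1|/IH2] [-> ->]];
    by rewrite ?subf_refl ?orbT.
by move=> /IH[-> ->]; rewrite !orbT.
Qed.

Lemma subf_Box chi phi : Box phi \in subf chi -> phi \in subf chi.
Proof.
elim: chi => [p|//|chi1 IH1 chi2 IH2|chi IH] //=; rewrite !inE //=.
  by rewrite !mem_cat => /orP[/IH1|/IH2] ->; rewrite ?orbT.
by move=> /orP[/eqP[->]|/IH ->]; rewrite ?subf_refl ?orbT.
Qed.

Definition sub_closure G : {fset formula PropVar} :=
  [fset phi in flatten (map subf (enum_fset G))].

Lemma sub_closureP G phi :
  reflect (exists2 chi, chi \in G & phi \in subf chi) (phi \in sub_closure G).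
Proof. by rewrite in_fset; exact: (iffP flatten_mapP). Qed.

Lemma sub_closure_sub G : G `<=` sub_closure G.
Proof.
by apply/fsubsetP=> phi phiG; apply/sub_closureP; exists phi; rewrite ?subf_refl.
Qed.

Lemma sub_closure_closed G : sub_closed (sub_closure G).
Proof.
split=> [phi psi|phi] /sub_closureP[chi chiG].
  by case/subf_Imp=> ? ?; split; apply/sub_closureP; exists chi.
by move/subf_Box=> ?; apply/sub_closureP; exists chi.
Qed.

(** Each clause reads a rule upwards: (→left), (→right) and, for S-sequents only, (S□left). *)
Definition saturated a G D : Prop :=
  [/\ forall phi psi, Imp phi psi \in G -> phi \in D \/ psi \in G,
      forall phi psi, Imp phi psi \in D -> phi \in G /\ psi \in D
    & a = ArrS -> forall phi, Box phi \in G -> phi \in G].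

(** * Maximal underivable sequents *)

Lemma fproper_witness (K : choiceType) (A B : {fset K}) x :
  A `<=` B -> x \in B -> x \notin A -> A `<` B.
Proof.
by move=> AB xB xA; rewrite fproperE AB; apply: contra xA => /fsubsetP; exact.
Qed.

(** Formulas of [U] are added to either side as long as the sequent stays underivable; the number of
    formulas of [U] still missing decreases. *)
Lemma maximal_unprovable a U G D :
  G `<=` U -> D `<=` U -> ~ cf a G D ->
  exists G' D', [/\ G `<=` G' /\ G' `<=` U, D `<=` D' /\ D' `<=` U, ~ cf a G' D',
    forall phi, phi \in U -> ~ cf a (phi |` G') D' -> phi \in G'
  & forall phi, phi \in U -> ~ cf a G' (phi |` D') -> phi \in D'].
Proof.
have [n] := ubnP (#|` U `\` G| + #|` U `\` D|).
have shrink (X : {fset formula PropVar}) phi : phi \in U -> phi \notin X ->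
    #|` U `\` (phi |` X)| < #|` U `\` X|.
  move=> phiU phiX; apply: fproper_ltn_card; apply: (@fproper_witness _ _ _ phi).
  - by apply: fsetDS; exact: fsubsetU1.
  - by rewrite in_fsetD phiX.
  - by rewrite in_fsetD fset1U1.
elim: n G D => // n IHn G D; rewrite ltnS => le_n GU DU nGD.
have [[phi [phiU nphi phiG]]|maxG] := classic (exists phi,
    [/\ phi \in U, ~ cf a (phi |` G) D & phi \notin G]).
  have [||||G' [D' [[sG ?] ? ? ? ?]]] := IHn (phi |` G) D; rewrite ?fsubUset ?fsub1set ?phiU //.
    by apply: leq_trans le_n; rewrite ltn_add2r shrink.
  by exists G', D'; split=> //; split=> //; move: sG; rewrite fsubUset => /andP[].
have [[phi [phiU nphi phiD]]|maxD] := classic (exists phi,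
    [/\ phi \in U, ~ cf a G (phi |` D) & phi \notin D]).
  have [||||G' [D' [? [sD ?] ? ? ?]]] := IHn G (phi |` D); rewrite ?fsubUset ?fsub1set ?phiU //.
    by apply: leq_trans le_n; rewrite ltn_add2l shrink.
  by exists G', D'; split=> //; split=> //; move: sD; rewrite fsubUset => /andP[].
exists G, D; split=> // phi phiU nphi; apply: contraT => phiN.
  by case: maxG; exists phi.
by case: maxD; exists phi.
Qed.

Lemma saturation a U G D : sub_closed U ->
  G `<=` U -> D `<=` U -> ~ cf a G D ->
  exists G' D', [/\ G `<=` G' /\ G' `<=` U, D `<=` D' /\ D' `<=` U, ~ cf a G' D'
                  & saturated a G' D'].
Proof.
move=> [U_imp U_box] GU DU /(maximal_unprovable GU DU).
case=> G' [D' [[sG G'U] [sD D'U] nGD maxG maxD]].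
exists G', D'; split=> //; split.
- move=> phi psi impG; have [phiU psiU] := U_imp _ _ (fsubsetP G'U _ impG).
  apply: NNPP => /not_or_and[phiD psiG]; apply: nGD.
  (* The principal formula already belongs to the antecedent, so the rule concludes the very sequent
     assumed underivable. *)
  rewrite -(mem_fset1U impG); apply: D3_impL; apply: NNPP.
    by move=> /(maxD _ phiU).
  by move=> /(maxG _ psiU).
- move=> phi psi impD; have [phiU psiU] := U_imp _ _ (fsubsetP D'U _ impD).
  have nprem : ~ cf a (phi |` G') (psi |` D').
    by move=> prem; apply: nGD; rewrite -(mem_fset1U impD); exact: D3_impR.
  split; [apply: maxG => // | apply: maxD => //] => H; apply: nprem.
    by apply: D3_weak H; rewrite ?fsubset_refl ?fsubsetU1.
  by apply: D3_weak H; rewrite ?fsubset_refl ?fsubsetU1.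
- move=> aS phi boxG; have phiU := U_box _ (fsubsetP G'U _ boxG).
  apply: maxG => // H; apply: nGD; rewrite -(mem_fset1U boxG) aS.
  by apply: D3_SboxL; rewrite -aS.
Qed.

Lemma unprovable_disjoint a G D phi : ~ cf a G D -> phi \in G -> phi \notin D.
Proof.
move=> nGD phiG; apply/negP=> phiD; apply: nGD.
by apply: D3_weak (D3_init false a phi); rewrite fsub1set.
Qed.

Lemma unprovable_Bot a G D : ~ cf a G D -> ~ Bot \in G.
Proof.
move=> nGD botG; apply: nGD.
by apply: D3_weak (D3_bot _ false a); rewrite ?fsub1set ?fsub0set.
Qed.

Lemma saturated_truth a (M : kripke_model PropVar) (w : M) G D :
  ~ cf a G D -> saturated a G D ->
  (forall p, Var p \in G -> valuation w p) ->
  (forall p, Var p \in D -> ~~ valuation w p) ->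
  (forall phi, Box phi \in G -> truth w (Box phi)) ->
  (forall phi, Box phi \in D -> ~ truth w (Box phi)) ->
  forall phi, (phi \in G -> truth w phi) /\ (phi \in D -> ~ truth w phi).
Proof.
move=> nGD [satG satD _] vG vD bG bD; elim=> [p||phi [IG1 ID1] psi [IG2 ID2]|phi _].
- by split=> [/vG|/vD/negP].
- by split=> [|_ []]; first exact: unprovable_Bot nGD.
- split=> [/satG[/ID1 nphi /nphi|/IG2 tpsi _] //|/satD[/IG1 tphi /ID2 npsi] imp].
  exact/npsi/imp.
- by split; [exact: bG|exact: bD].
Qed.

Definition unbox_opt phi : option (formula PropVar) :=
  if phi is Box psi then Some psi else None.

Definition unbox G : {fset formula PropVar} :=
  [fset phi in pmap unbox_opt (enum_fset G)].

Lemma mem_unbox G phi : (phi \in unbox G) = (Box phi \in G).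
Proof.
rewrite in_fset mem_pmap; apply/mapP/idP => [[[] //= psi psiG [->]] //|phiG].
by exists (Box phi).
Qed.

Lemma BoxSet_unbox_sub G : BoxSet (unbox G) `<=` G.
Proof. by apply/fsubsetP=> _ /imfsetP[phi /= + ->]; rewrite mem_unbox. Qed.

(** * Completeness of the cut-free GL fragment *)

Section Canonical.
Variable U : {fset formula PropVar}.
Hypothesis U_closed : sub_closed U.

Definition canon_world : Type :=
  {w : {fset formula PropVar} * {fset formula PropVar} |
    [/\ w.1 `<=` U, w.2 `<=` U, ~ cf ArrGL w.1 w.2 & saturated ArrGL w.1 w.2]}.

(** The first inclusion makes boxes of the antecedent true; the strict growth of the boxed part
    gives converse well-foundedness, [U] being finite. *)
Definition canon_acc (w v : canon_world) : Prop :=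
  unbox (sval w).1 `<=` (sval v).1 /\ unbox (sval w).1 `<` unbox (sval v).1.

Definition canon_model (w0 : canon_world) : kripke_model PropVar :=
  @KripkeModel PropVar canon_world (inhabits w0) canon_acc
    (fun w p => Var p \in (sval w).1).

Lemma canon_GL w0 : GL_model (canon_model w0).
Proof.
split=> [x y z [_ xy] [yz1 yz2]|[x chain]].
  split; last exact: fsub_proper_trans (fproper_sub xy) yz2.
  exact: fsubset_trans (fproper_sub xy) yz1.
(* Along a chain the boxed part gains a formula at each step, yet it stays inside [U]. *)
have grow n : n <= #|` unbox (sval (x n)).1|.
  elim: n => // n IHn; have [_ /fproper_ltn_card] := chain n.
  exact: leq_ltn_trans.
have := grow #|` U|.+1; apply/negP; rewrite -ltnNge ltnS.
apply: fsubset_leq_card; apply/fsubsetP=> phi; rewrite mem_unbox => phiG.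
have [GU _ _ _] := svalP (x #|` U|.+1).
by apply: (proj2 U_closed); exact: fsubsetP GU _ phiG.
Qed.

(** Only a box in the succedent calls for a new world, obtained by saturating the corresponding
    premise of (GL□). *)
Lemma canon_truth w0 (w : canon_model w0) phi :
  (phi \in (sval w).1 -> truth w phi) /\ (phi \in (sval w).2 -> ~ truth w phi).
Proof.
elim: phi w => [p|/=|phi IH1 psi IH2|phi IH] w;
  have [GU DU nGD sat] := svalP w; have [satG satD _] := sat.
- split=> //= pD; apply/negP; apply: contraL pD.
  exact: unprovable_disjoint nGD.
- by split=> [|_ []]; first exact: unprovable_Bot nGD.
- have [IG1 ID1] := IH1 w; have [IG2 ID2] := IH2 w.
  split=> [/satG[/ID1 nphi /nphi|/IG2 tpsi _] //|/satD[/IG1 tphi /ID2 npsi] imp].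
  exact/npsi/imp.
- split=> [boxG v [/fsubsetP wv _]|boxD tbox].
    by apply: (proj1 (IH v)); apply: wv; rewrite mem_unbox.
  set G := unbox (sval w).1.
  have nprem : ~ cf ArrGL (Box phi |` (G `|` BoxSet G)) [fset phi].
    move=> /D3_GLbox H; apply: nGD; apply: D3_weak H; first exact: BoxSet_unbox_sub.
    by rewrite fsub1set.
  have boxU := fsubsetP DU _ boxD; have phiU := proj2 U_closed _ boxU.
  have [||G' [D' [[sG G'U] [sD D'U] nGD' sat']]] := saturation U_closed _ _ nprem.
  + rewrite !fsubUset fsub1set boxU /= (fsubset_trans (BoxSet_unbox_sub _) GU) andbT.
    apply/fsubsetP=> psi; rewrite mem_unbox => psiG.
    by apply: (proj2 U_closed); exact: fsubsetP GU _ psiG.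
  + by rewrite fsub1set.
  pose v : canon_model w0 :=
    exist _ (G', D') (And4 G'U D'U nGD' sat').
  move: sG; rewrite !fsubUset fsub1set => /and3P[boxG' GG' BGG'].
  (* Strictness is witnessed by [phi]: the premise puts [Box phi] in the antecedent of [v], whereas
     in [w] it lies in the succedent. *)
  have wv : acc w v.
    split=> //=; apply: (@fproper_witness _ _ _ phi); rewrite ?mem_unbox //.
      apply/fsubsetP=> psi psiG; rewrite mem_unbox; apply: (fsubsetP BGG').
      by rewrite mem_BoxSet.
    by apply: contraL boxD; exact: unprovable_disjoint nGD.
  apply: (proj2 (IH v)) (tbox v wv).
  by apply: (fsubsetP sD); rewrite fset11.
Qed.

End Canonical.

Lemma GL_complete G D : ~ cf ArrGL G D ->
  exists (M : kripke_model PropVar) (w : M), GL_model M /\ ~ seq_true G D w.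
Proof.
pose U := sub_closure (G `|` D) => nGD.
have U_closed : sub_closed U by exact: sub_closure_closed.
have := sub_closure_sub (G `|` D); rewrite fsubUset => /andP[GU DU].
have [G' [D' [[sG G'U] [sD D'U] nGD' sat]]] := saturation U_closed GU DU nGD.
pose w : canon_world U := exist _ (G', D') (And4 G'U D'U nGD' sat).
exists (canon_model w), w; split; first exact: canon_GL.
case=> [phi /(fsubsetP sG)|phi /(fsubsetP sD)].
  exact: (proj1 (canon_truth U_closed (w : canon_model w) phi)).
exact: (proj2 (canon_truth U_closed (w : canon_model w) phi)).
Qed.

(** * Constant extensions and completeness *)

Section ConstantExtension.
Variables (d : Order.disp_t) (lam : bOrderType d).
Variables (M : kripke_model PropVar) (t0 : M) (bot_val : PropVar -> bool).

Definition cext_world : Type :=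
  (M + {alpha : ext_index lam | alpha != ext_index0 lam})%type.

(** [insub] fails exactly at index 0, which is thereby sent to [t0]. *)
Definition cext_t (alpha : ext_index lam) : cext_world :=
  if insub alpha is Some u then inr u else inl t0.

Definition cext_acc (y z : cext_world) : Prop :=
  [\/ exists x1 x2, [/\ y = inl x1, z = inl x2 & acc x1 x2],
      exists alpha beta, [/\ y = cext_t alpha, z = cext_t beta
                           & ext_index_lt beta alpha]
    | exists alpha x, [/\ y = cext_t alpha, z = inl x,
                          ext_index_lt (ext_index0 lam) alpha & acc t0 x]].

(** Constancy concerns only indices below lambda, so the valuation at the bottom is left as a
    parameter. *)
Definition cext_val (y : cext_world) (p : PropVar) : bool :=
  match y with
  | inl x => valuation x p
  | inr u => if val u is Some _ then valuation t0 p else bot_val p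
  end.

Definition cext_model : kripke_model PropVar :=
  @KripkeModel PropVar cext_world (inhabits (inl t0)) cext_acc cext_val.

Lemma cext_t0 : cext_t (ext_index0 lam) = inl t0.
Proof. by rewrite /cext_t insubF ?eqxx. Qed.

Lemma cext_tS alpha (a0 : alpha != ext_index0 lam) :
  cext_t alpha = inr (exist _ alpha a0).
Proof. by rewrite /cext_t (insubT (fun x => x != ext_index0 lam) a0). Qed.

Lemma cext_extension :
  model_extension (M := M) (M' := cext_model) (@inl M _) cext_t.
Proof.
split=> //; exists t0; split=> //.
- exact: cext_t0.
- split=> [x y [] //|a b /ext_index_gt0 a0 /ext_index_gt0 b0].
  by rewrite !cext_tS => -[].
- by move=> a x /ext_index_gt0 a0; rewrite cext_tS.
- case=> [x|[a a0]]; first by left; exists x.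
  by right; exists a; [exact/ext_index_gt0|rewrite cext_tS].
Qed.

Lemma cext_valS (a : lam) p :
  valuation (cext_t (Some a) : cext_model) p = valuation t0 p.
Proof.
have [->|a0] := eqVneq (Some a) (ext_index0 lam); first by rewrite cext_t0.
by rewrite cext_tS.
Qed.

Lemma cext_val_bot p : valuation (cext_t None : cext_model) p = bot_val p.
Proof. by rewrite cext_tS. Qed.

Lemma cext_constant : constant_extension (M' := cext_model) cext_t.
Proof. by move=> p a b; rewrite !cext_valS. Qed.

End ConstantExtension.

(** Variables carry over from index 0 by constancy. For a box in [G], S-saturation puts its body in
    [G], true at every [t_b] by induction on the formula. A box in [D] is refuted at a successor of
    [t0], which every [t_a] sees. *)
Lemma constant_extension_truth (d : Order.disp_t) (lam : bOrderType d)
    (M M' : kripke_model PropVar) (e : M -> M') (t : ext_index lam -> M') G D :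
  model_extension e t -> constant_extension t ->
  ~ cf ArrS G D -> saturated ArrS G D ->
  ~ seq_true G D (t (ext_index0 lam)) ->
  forall phi (a : lam), (phi \in G -> truth (t (Some a)) phi) /\
                        (phi \in D -> ~ truth (t (Some a)) phi).
Proof.
move=> ext cst nGD [satG satD satB] nseq.
have [tG nD] := imply_to_and _ _ nseq.
have [t0 [t00 acc_t]] := ext_root ext.
have tD phi : phi \in D -> ~ truth (t (ext_index0 lam)) phi.
  by move=> phiD tphi; apply: nD; exists phi.
elim=> [p||phi IH1 psi IH2|phi IH] a.
- have vE : truth (t (Some a)) (Var p) = truth (t (ext_index0 lam)) (Var p).
    by rewrite /= (cst p a \bot%O).
  by rewrite vE; split; [exact: tG|exact: tD].
- by split=> [|_ []]; first exact: unprovable_Bot nGD.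
- have [IG1 ID1] := IH1 a; have [IG2 ID2] := IH2 a.
  split=> [/satG[/ID1 nphi /nphi|/IG2 tpsi _] //|/satD[/IG1 tphi /ID2 npsi] imp].
  exact/npsi/imp.
have t0_e x : acc t0 x -> acc (t (ext_index0 lam)) (e x).
  by move=> t0x; rewrite t00; apply/(ext_acc_e ext); exists x.
have [aE|/ext_index_gt0 a0] := eqVneq (Some a) (ext_index0 lam).
  by rewrite aE; split; [exact: tG|exact: tD].
split=> [boxG z /(acc_t _ _ a0)[[[b|//] -> _]|[x -> t0x]]|boxD tbox].
- by apply: (proj1 (IH b)); exact: satB.
- exact: (tG _ boxG) (t0_e x t0x).
- apply: (tD _ boxD) => z; rewrite t00 => /(ext_acc_e ext)[x -> t0x].
  by apply: tbox; apply/(acc_t _ _ a0); right; exists x.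
Qed.

Lemma D_complete (d : Order.disp_t) (lam : bOrderType d) G D :
  ~ cf ArrD G D ->
  exists (M M' : kripke_model PropVar) (e : M -> M') (t : ext_index lam -> M'),
    [/\ GL_model M, model_extension e t, constant_extension t
      & ~ seq_true G D (t None)].
Proof.
move=> nGD; pose U := sub_closure (G `|` D).
have := sub_closure_sub (G `|` D); rewrite fsubUset => /andP[GU DU].
have [G1 [D1 [[sG1 G1U] [sD1 D1U] nGD1 sat1]]] :=
  saturation (sub_closure_closed _) GU DU nGD.
have nS : ~ cf ArrS (BoxSet (unbox G1)) (BoxSet (unbox D1)).
  by move=> /D3_StoD H; apply: nGD1; apply: D3_weak H; exact: BoxSet_unbox_sub.
have [||G2 [D2 [[sG2 _] [sD2 _] nGD2 sat2]]] :=
  saturation (sub_closure_closed (G `|` D)) _ _ nS.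
- exact: fsubset_trans (BoxSet_unbox_sub _) G1U.
- exact: fsubset_trans (BoxSet_unbox_sub _) D1U.
have [|M [t0 [GLM n0]]] := @GL_complete G2 D2.
  by move=> H; apply: nGD2; exact: D3_GLtoS.
(* The variables at the bottom come from the saturated D-sequent, independently of [t0]. *)
pose bot_val p := Var p \in G1.
have ext := cext_extension lam t0 bot_val.
have cst := @cext_constant d lam M t0 bot_val.
exists M, (cext_model lam t0 bot_val), (@inl M _), (cext_t t0); split=> //.
have n0' : ~ seq_true G2 D2 (cext_t t0 (ext_index0 lam) : cext_model lam t0 bot_val).
  move=> H; apply: n0 => tG; have [phi|phi phiD tphi] := H.
    by rewrite cext_t0 => phiG; apply/(ext_truth_e ext)/tG.
  exists phi => //; move: tphi; rewrite cext_t0.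
  by move/(ext_truth_e ext).
have tr2 := constant_extension_truth ext cst nGD2 sat2 n0'.
have satB : forall phi, Box phi \in G2 -> phi \in G2 by case: sat2 => _ _ /(_ erefl).
have [t0' [t00 acc_t]] := ext_root ext.
have accN x : acc t0' x -> acc (cext_t t0 None : cext_model lam t0 bot_val) (inl x).
  by move=> t0x; apply/(acc_t None _ I); right; exists x.
have acc0 z : acc (cext_t t0 (ext_index0 lam) : cext_model lam t0 bot_val) z <->
    exists2 x, z = inl x & acc t0' x.
  by rewrite t00; exact: ext_acc_e ext _ _.
have inG2 phi : Box phi \in G1 -> Box phi \in G2.
  by move=> boxG; apply: (fsubsetP sG2); rewrite mem_BoxSet mem_unbox.
have inD2 phi : Box phi \in D1 -> Box phi \in D2.
  by move=> boxD; apply: (fsubsetP sD2); rewrite mem_BoxSet mem_unbox.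
have tr1 phi : (phi \in G1 -> truth (cext_t t0 None : cext_model lam t0 bot_val) phi)
    /\ (phi \in D1 -> ~ truth (cext_t t0 None : cext_model lam t0 bot_val) phi).
  move: phi; apply: (saturated_truth nGD1 sat1) => [p pG|p pD|phi boxG z|phi boxD tbox].
  - by rewrite cext_val_bot.
  - by rewrite cext_val_bot; apply: contraL pD; exact: unprovable_disjoint nGD1.
  (* At [t_a], the body is in [G2] by S-saturation and hence true; old successors are also seen from
     index 0, where the box holds. *)
  - case/(acc_t None _ I)=> [[[a|//] -> _]|[x -> t0x]].
      by apply: (proj1 (tr2 phi a)); apply/satB/inG2.
    by apply: (proj1 (tr2 _ \bot%O) (inG2 _ boxG)); apply/acc0; exists x.
  (* The box already fails at index 0, whose successors are all seen from the bottom. *)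
  - apply: (proj2 (tr2 _ \bot%O) (inD2 _ boxD)) => z /acc0[x -> t0x].
    by apply: tbox; exact: accN.
case=> [phi /(fsubsetP sG1)|phi /(fsubsetP sD1)].
  exact: (proj1 (tr1 phi)).
exact: (proj2 (tr1 phi)).
Qed.

(** * The circle of implications *)

Lemma cut_free_derivable c a G D : cf a G D -> D3seq c a G D.
Proof.
elim=> {a G D}.
- by move=> *; exact: D3_init.
- by move=> *; exact: D3_bot.
- by move=> a G D G' D' sG sD _; exact: D3_weak.
- by move=> *; exact: D3_impL.
- by move=> *; exact: D3_impR.
(* The guard of the cut rule reads [false = true] here. *)
- by [].
- by move=> *; exact: D3_GLbox.
- by move=> *; exact: D3_GLtoS.
- by move=> *; exact: D3_SboxL.
- by move=> *; exact: D3_StoD.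
Qed.

End Sequents.

Theorem theorem5p8 (PropVar : choiceType) (d : Order.disp_t)
    (lam : bOrderType d) (Hlam : limit_ordinal lam)
    (Psi Phi : {fset formula PropVar}) :
  [<-> D3seq true ArrD Psi Phi;
       D3seq false ArrD Psi Phi;
       forall (M M' : kripke_model PropVar) (e : M -> M')
              (t : ext_index lam -> M'),
         GL_model M -> model_extension e t -> constant_extension t ->
         truth (bottom_world t) (Imp (BigAnd Psi) (BigOr Phi));
       forall (M M' : kripke_model PropVar) (e : M -> M')
              (t : ext_index lam -> M'),
         GL_model M -> model_extension e t ->
         truth (bottom_world t) (Imp (BigAnd Psi) (BigOr Phi))].
Proof.
set P1 := D3seq true _ _ _; set P2 := D3seq false _ _ _.
set P3 := forall M M' e t, _ -> _ -> constant_extension _ -> _.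
set P4 := forall M M' e t, _ -> _ -> _.
have H14 : P1 -> P4.
  move=> der M M' e t GLM ext; apply/truth_sequent.
  exact: (D3seq_sound ext Hlam GLM der).
have H43 : P4 -> P3 by move=> H M M' e t GLM ext _; exact: H GLM ext.
have H32 : P3 -> P2.
  move=> H; apply: NNPP => /(D_complete lam)[M [M' [e [t [GLM ext cst]]]]].
  by apply; apply/truth_sequent; exact: H GLM ext cst.
have H21 : P2 -> P1 by exact: cut_free_derivable.
(* The implications between consecutive conditions of the list arise by composing the four proved
   above. *)
by tfae; auto.
Qed.
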